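(* Let $\alpha\in(1,2)$, $s^\star=\sqrt{\alpha(2-\alpha)}$, and let $\lambda^\star(\beta)=\mathcal B_S^{-1}(\beta)$ be as defined in the context. Let $$C(\alpha)=\Bigl(\tfrac{\alpha-1}{\alpha}\Bigr)^{\alpha/2}\Bigl(\tfrac{2-\alpha}{\alpha-1}\Bigr)^{(2-\alpha)/2},\qquad L(\alpha)=\frac{\alpha\,C(\alpha)^{1/\alpha}}{(\alpha-1)^{(\alpha-1)/\alpha}} .$$ Then $$s^\star\bigl(2\lambda^\star(\beta)\bigr)^{(\alpha-1)/\alpha}=L(\alpha)\,\bigl(\log(1/\beta)\bigr)^{(\alpha-1)/\alpha}\,(1+o(1))\qquad\text{as }\beta\downarrow0 .$$
   Context: For $\mu_1,\mu_2\ge0$, $\mathrm{Skellam}(\mu_1,\mu_2)$ is the law of $N_1-N_2$ with $N_1\sim\mathrm{Poisson}(\mu_1)$, $N_2\sim\mathrm{Poisson}(\mu_2)$ independent. For $\lambda\ge0$ let $S\sim\mathrm{Skellam}(\lambda(1+s^\star),\lambda(1-s^\star))$ and $\mathcal B_S(\lambda)=P[S<0]+\tfrac12P[S=0]$. The function $\mathcal B_S$ is continuous and strictly decreasing on $[0,\infty)$ from $\mathcal B_S(0)=\tfrac12$ to $\mathcal B_S(\infty)=0$, so its inverse $\lambda^\star(\beta)=\mathcal B_S^{-1}(\beta)$ is well defined on $(0,\tfrac12)$. *)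

(* Defs.v *)
From HB Require Import structures.
From mathcomp Require Import all_boot all_order all_algebra.
From mathcomp Require Import all_classical all_reals all_analysis.

Set Implicit Arguments.
Unset Strict Implicit.
Unset Printing Implicit Defensive.

Import Order.TTheory GRing.Theory Num.Theory.
Import numFieldNormedType.Exports.

Local Open Scope classical_set_scope.
Local Open Scope ring_scope.

Definition natdiff (R : realType) (n : nat * nat) : R := n.1%:R - n.2%:R.

Lemma measurable_natdiff (R : realType) :
  measurable_fun [set: nat * nat] (@natdiff R).
Proof.
have mnat : measurable_fun [set: nat] (fun n : nat => n%:R : R) by [].
apply: measurable_realfun.measurable_funB.
- exact: (measurableT_comp mnat measurable_fst).
- exact: (measurableT_comp mnat measurable_snd).
Qed.

HB.instance Definition _ (R : realType) :=
  isMeasurableFun.Build _ _ (nat * nat)%type R (@natdiff R)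
    (@measurable_natdiff R).

(* The second argument 0 of [poisson_prob] is a dummy: the library's definition
   does not use it.  At rate 0, [poisson_prob] is the Dirac mass at 0.
   Independence of the two Poisson variables is expressed by the product
   measure; the integer-valued difference is seen in R with its Borel sets. *)
Definition skellam (R : realType) (mu1 mu2 : R) : probability R R :=
  distribution (poisson_prob mu1 0 \x poisson_prob mu2 0)%E (@natdiff R).

Definition s_star (R : realType) (alpha : R) : R :=
  Num.sqrt (alpha * (2 - alpha)).

Definition B_S (R : realType) (alpha lambda : R) : R :=
  let P := skellam (lambda * (1 + s_star alpha))
                   (lambda * (1 - s_star alpha)) in
  fine (P [set s | s < 0]) + 2^-1 * fine (P [set 0]).

(* Inverse of the restriction of B_S alpha to [0, +oo[; the default value 0 is
   taken only outside the image of [0, +oo[. *)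
Definition lambda_star (R : realType) (alpha : R) : R -> R :=
  'pinv_(fun=> 0) `[0, +oo[ (B_S alpha).

Definition C_const (R : realType) (alpha : R) : R :=
  ((alpha - 1) / alpha) `^ (alpha / 2) *
  ((2 - alpha) / (alpha - 1)) `^ ((2 - alpha) / 2).

Definition L_const (R : realType) (alpha : R) : R :=
  alpha * C_const alpha `^ alpha^-1 /
  (alpha - 1) `^ ((alpha - 1) / alpha).

(* Main.v *)
Require Import Defs.
From mathcomp Require Import all_boot all_order all_algebra.
From mathcomp Require Import all_classical all_reals all_analysis.
From mathcomp Require Import ring lra.

Import Order.TTheory GRing.Theory Num.Theory.
Import numFieldNormedType.Exports.

Local Open Scope classical_set_scope.
Local Open Scope ring_scope.

(* Everything follows from comparing two product Poisson laws atom by atom.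
   Raising the rates by a total of d multiplies each atom by at least exp (-d),
   so B_S is Lipschitz and lambda_star is a genuine right inverse by the
   intermediate value theorem.  Tilting N1 by t and N2 by 1/t with
   t = (alpha - 1) / (1 + s), where s^2 = 1 - (alpha - 1)^2, gives the Chernoff
   bound B_S lambda <= exp (-2 lambda (2 - alpha)).  Conversely the single atom
   N1 = N2 = k with k close to lambda (alpha - 1) shows that this bound is sharp
   up to a polynomial factor.  Hence log (1/beta) ~ 2 lambda_star (2 - alpha),
   and L (2 - alpha)^((alpha - 1) / alpha) = s. *)

(** * Comparison of measures through their atoms *)

Lemma setX11 (T U : Type) (x : T) (y : U) :
  [set x] `*` [set y] = [set (x, y)].
Proof. by apply/seteqP; split=> [[a b] [/= -> ->]|_ ->]. Qed.

Lemma measurable_natprod (A : set (nat * nat)) : measurable A.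
Proof.
apply: countable_measurable => [[i j]|]; last exact: countableP.
by rewrite -setX11; exact: measurableX.
Qed.

(** The injection into [nat] cuts [A] into countably many disjoint slices, each empty or a
    singleton; sigma-additivity then sums the atomwise inequalities. *)
Lemma le_measure_atoms (d : measure_display) (T : measurableType d)
    (R : realType) (mu nu : {measure set T -> \bar R}) (f : T -> nat) (c : R)
    (A : set T) :
  injective f -> (forall B : set T, measurable B) -> 0 <= c ->
  (forall x, A x -> c%:E * mu [set x] <= nu [set x])%E ->
  (c%:E * mu A <= nu A)%E.
Proof.
move=> f_inj mT c0 le_at.
pose F n := A `&` f @^-1` [set n].
have AE : A = \bigcup_n F n.
  by apply/seteqP; split=> [x Ax|x [n _ []//]]; exists (f x).
have tF : trivIset setT F.
  apply/trivIsetP => i j _ _ /eqP ij; rewrite -subset0.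
  move=> x [[_ /= fi] [_ /= fj]].
  by apply: ij; rewrite -fi -fj.
rewrite AE !measure_bigcup//.
rewrite -nneseriesZl//; apply: lee_nneseries => [n _ _|n _].
  by rewrite mule_ge0.
have [[x [Ax fx]]|] := pselect (exists x, F n x); last first.
  move=> /forallNP Fn0; have -> : F n = set0 by rewrite -subset0 => x /Fn0.
  by rewrite !measure0 mule0.
suff -> : F n = [set x] by exact: le_at.
by apply/seteqP; split=> y /= => [[Ay fy]|->//]; apply: f_inj; rewrite fy fx.
Qed.

(** * Poisson atoms and the product law on pairs *)

Definition poisson_mass (R : realType) (r : R) (k : nat) : R :=
  r ^+ k / k`!%:R * expR (- r).

Lemma poisson_mass_ge0 (R : realType) (r : R) k :
  0 <= r -> 0 <= poisson_mass R r k.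
Proof.
by move=> r0; rewrite /poisson_mass !mulr_ge0 ?exprn_ge0 ?invr_ge0 ?expR_ge0.
Qed.

Lemma poisson_prob_set1 (R : realType) (r : R) k : 0 <= r ->
  poisson_prob r 0 [set k] = (poisson_mass R r k)%:E.
Proof.
rewrite le_eqVlt => /predU1P[<-|r0]; rewrite /poisson_prob /poisson_mass.
  rewrite ltxx diracE oppr0 expR0 mulr1 expr0n.
  rewrite in_set1 eq_sym; case: eqP => [->|_] /=; last by rewrite mul0r.
  by rewrite fact0 divr1.
rewrite r0 esum_set1 /poisson_pmf r0//.
by rewrite lee_fin !mulr_ge0 ?exprn_ge0 ?expR_ge0 ?ltW.
Qed.

Definition poisson_pair (R : realType) (a b : R) :
    probability (nat * nat)%type R :=
  (poisson_prob a 0 \x poisson_prob b 0)%E.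

(** Real values let [lra] and [ring] work on probabilities; all sets of pairs are measurable, so no
    side condition remains. *)
Definition poisson2 (R : realType) (a b : R) (A : set (nat * nat)) : R :=
  fine (poisson_pair R a b A).

Lemma poisson2E (R : realType) (a b : R) (A : set (nat * nat)) :
  (poisson2 R a b A)%:E = poisson_pair R a b A.
Proof.
by rewrite /poisson2 fineK// fin_num_measure//; exact: measurable_natprod.
Qed.

Lemma poisson2_set1 (R : realType) (a b : R) (k j : nat) : 0 <= a -> 0 <= b ->
  poisson2 R a b [set (k, j)] = poisson_mass R a k * poisson_mass R b j.
Proof.
move=> a0 b0; apply: EFin_inj; rewrite poisson2E -setX11.
transitivity (poisson_prob a 0 [set k] * poisson_prob b 0 [set j])%E.
  exact: product_measure1E.
by rewrite !poisson_prob_set1.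
Qed.

Lemma poisson2_ge0 (R : realType) (a b : R) A : 0 <= poisson2 R a b A.
Proof. exact: fine_ge0. Qed.

Lemma poisson2_le (R : realType) (a b : R) A B : A `<=` B ->
  poisson2 R a b A <= poisson2 R a b B.
Proof.
move=> AB; rewrite -lee_fin !poisson2E.
by apply: le_measure => //; rewrite inE; exact: measurable_natprod.
Qed.

Lemma poisson2U (R : realType) (a b : R) A B : A `&` B = set0 ->
  poisson2 R a b (A `|` B) = poisson2 R a b A + poisson2 R a b B.
Proof.
move=> AB; apply: EFin_inj; rewrite EFinD !poisson2E.
by rewrite measureU//; exact: measurable_natprod.
Qed.

Lemma poisson2_setC (R : realType) (a b : R) A :
  poisson2 R a b (~` A) = 1 - poisson2 R a b A.
Proof.
apply: EFin_inj; rewrite EFinB !poisson2E.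
rewrite probability_setC//; exact: measurable_natprod.
Qed.

Lemma poisson2_le1 (R : realType) (a b : R) A : poisson2 R a b A <= 1.
Proof. by rewrite -subr_ge0 -poisson2_setC poisson2_ge0. Qed.

Lemma poisson2_compare (R : realType) (a b a' b' c : R) (A : set (nat * nat)) :
  0 <= a -> 0 <= b -> 0 <= a' -> 0 <= b' -> 0 <= c ->
  (forall k j, A (k, j) -> c * (poisson_mass R a k * poisson_mass R b j) <=
     poisson_mass R a' k * poisson_mass R b' j) ->
  c * poisson2 R a b A <= poisson2 R a' b' A.
Proof.
move=> a0 b0 a'0 b'0 c0 H; rewrite -lee_fin EFinM !poisson2E.
apply: (@le_measure_atoms _ _ _ _ _ (fun x : nat * nat => pickle x)) => //.
  exact: measurable_natprod.
by move=> [k j] /H; rewrite -!poisson2_set1// -lee_fin EFinM !poisson2E.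
Qed.

(** * Change of rates: raising and exponential tilting *)

Lemma poisson_mass_raise (R : realType) (r r' : R) k : 0 <= r <= r' ->
  expR (- (r' - r)) * poisson_mass R r k <= poisson_mass R r' k.
Proof.
move=> /andP[r0 rr']; rewrite /poisson_mass mulrCA -expRD.
rewrite (_ : - (r' - r) - r = - r'); last by ring.
rewrite ler_wpM2r ?expR_ge0// ler_wpM2r ?invr_ge0//.
by rewrite lerXn2r// nnegrE// (le_trans r0).
Qed.

(** Exponential tilting: the weight [t ^+ k] changes the rate [r] into [t * r], and the normalising
    factor is the Poisson generating function at [t]. *)
Lemma poisson_mass_tilt (R : realType) (r t : R) k :
  t ^+ k * poisson_mass R r k = expR ((t - 1) * r) * poisson_mass R (t * r) k.
Proof.
rewrite /poisson_mass exprMn.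
rewrite [RHS](_ : _ = t ^+ k * (r ^+ k / k`!%:R *
  (expR ((t - 1) * r) * expR (- (t * r))))); last by ring.
by rewrite -expRD; congr (_ * (_ * expR _)); ring.
Qed.

Lemma poisson2_raise (R : realType) (a b a' b' : R) A :
  0 <= a <= a' -> 0 <= b <= b' ->
  expR (- ((a' - a) + (b' - b))) * poisson2 R a b A <= poisson2 R a' b' A.
Proof.
move=> /[dup] aa' /andP[a0 /(le_trans a0) a'0].
move=> /[dup] bb' /andP[b0 /(le_trans b0) b'0].
apply: poisson2_compare => //.
move=> k j _; rewrite opprD expRD [leLHS]mulrACA.
apply: ler_pM; [apply: mulr_ge0|apply: mulr_ge0|exact: poisson_mass_raise
  |exact: poisson_mass_raise]; by rewrite ?expR_ge0 ?poisson_mass_ge0.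
Qed.

Lemma poisson2_dist (R : realType) (a b a' b' : R) A :
  0 <= a <= a' -> 0 <= b <= b' ->
  `|poisson2 R a' b' A - poisson2 R a b A| <= (a' - a) + (b' - b).
Proof.
move=> aa' bb'; set d := (X in _ <= X).
have d0 : 0 <= d by move: aa' bb'; rewrite /d; lra.
(* As [expR (- d) >= 1 - d], raising the rates removes at most [d * p <= d] from the probability [p]
   of any set. *)
have loss B : poisson2 R a b B - poisson2 R a' b' B <= d.
  have := @poisson2_raise R a b a' b' B aa' bb'; rewrite -/d.
  have := poisson2_ge0 R a b B; have := poisson2_le1 R a b B.
  move: (poisson2 R a b B) (poisson2 R a' b' B) => p p' p1 p0 le_p.
  have dp : d * p <= d by rewrite ler_piMr.
  have ep : (1 - d) * p <= expR (- d) * p by rewrite ler_wpM2r// expR_ge1Dx.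
  lra.
(* the bound on the complement gives the opposite inequality *)
have := loss (~` A); have := loss A; rewrite !poisson2_setC.
move: (poisson2 R a b A) (poisson2 R a' b' A) => p p' lossA lossC.
rewrite ler_norml; lra.
Qed.

(** Where [k <= j], the weight [t ^+ k * t^-1 ^+ j] is at least 1, so each atom is dominated by its
    tilted version; the tilted law has total mass 1. *)
Lemma poisson2_le_chernoff (R : realType) (a b t : R) :
  0 <= a -> 0 <= b -> 0 < t <= 1 ->
  poisson2 R a b [set x | (x.1 <= x.2)%N] <=
    expR ((t - 1) * a + (t^-1 - 1) * b).
Proof.
move=> a0 b0 /andP[t0 t1]; set e := (X in expR X).
suff /le_trans : expR (- e) * poisson2 R a b [set x | (x.1 <= x.2)%N] <=
    poisson2 R (t * a) (t^-1 * b) [set x | (x.1 <= x.2)%N].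
  move=> /(_ _ (poisson2_le1 _ _ _ _)).
  by rewrite expRN mulrC ler_pdivrMr ?expR_gt0// mul1r.
apply: poisson2_compare => //;
  rewrite ?expR_ge0 ?mulr_ge0 ?invr_ge0 ?(ltW t0)//.
move=> k j /= kj; rewrite expRN mulrC ler_pdivrMr ?expR_gt0//.
rewrite [leRHS](_ : _ = (expR ((t - 1) * a) * poisson_mass R (t * a) k) *
  (expR ((t^-1 - 1) * b) * poisson_mass R (t^-1 * b) j)); last first.
  by rewrite /e expRD; ring.
rewrite -!poisson_mass_tilt [leRHS]mulrACA ler_peMl//.
  by apply: mulr_ge0; exact: poisson_mass_ge0.
by rewrite exprVn ler_pdivlMr ?exprn_gt0// mul1r ler_wiXn2l// ltW.
Qed.

(** * The function [B_S]: Lipschitz continuity and two-sided bounds *)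

Lemma natdiff_lt0 (R : realType) :
  @natdiff R @^-1` [set s | s < 0] = [set x | (x.1 < x.2)%N].
Proof.
by apply/seteqP; split=> -[i j] /=; rewrite /natdiff /= subr_lt0 ltr_nat.
Qed.

Lemma natdiff_eq0 (R : realType) :
  @natdiff R @^-1` [set 0] = [set x | x.1 = x.2].
Proof.
apply/seteqP; split=> -[i j] /=; rewrite /natdiff /=.
  by move=> /eqP; rewrite subr_eq0 eqr_nat => /eqP.
by move=> ->; rewrite subrr.
Qed.

Lemma B_SE (R : realType) (alpha lambda : R) :
  let P := poisson2 R (lambda * (1 + s_star alpha))
                      (lambda * (1 - s_star alpha)) in
  B_S alpha lambda =
    P [set x | (x.1 < x.2)%N] + 2^-1 * P [set x | x.1 = x.2].
Proof. by rewrite /= -(natdiff_lt0 R) -(natdiff_eq0 R). Qed.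

Section skellam_rates.
Context {R : realType} {alpha : R} (halpha : 1 < alpha < 2).
Local Notation s := (s_star alpha).

Lemma s_star_sqr : s ^+ 2 = 1 - (alpha - 1) ^+ 2.
Proof.
rewrite sqr_sqrtr; first by ring.
by move/andP: halpha => [? ?]; rewrite mulr_ge0//; lra.
Qed.

Lemma s_star_bounds : 0 <= s < 1.
Proof.
rewrite sqrtr_ge0 /= -(@ltr_pXn2r _ 2) ?nnegrE ?sqrtr_ge0// s_star_sqr expr1n.
by move/andP: halpha => [? ?]; rewrite ltrBlDr ltrDl exprn_gt0//; lra.
Qed.

Lemma poisson_ratesP (lambda : R) : 0 <= lambda ->
  0 <= lambda * (1 + s) /\ 0 <= lambda * (1 - s).
Proof. by move=> l0; have := s_star_bounds; split; rewrite mulr_ge0//; lra. Qed.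

Lemma B_S_0 : B_S alpha 0 = 2^-1.
Proof.
rewrite B_SE !mul0r.
set P := poisson2 R 0 0.
have P0 : P [set (0%N, 0%N)] = 1.
  rewrite /P poisson2_set1// /poisson_mass.
  by rewrite expr0 oppr0 expR0 fact0 divr1 !mulr1.
have P1 : P [set x | x.1 = x.2] = 1.
  apply/eqP; rewrite eq_le poisson2_le1 -P0.
  by apply: poisson2_le => _ ->.
have : P [set x | (x.1 < x.2)%N] <= P (~` [set (0%N, 0%N)]).
  by apply: poisson2_le => -[i j] /= ij [i0 j0]; rewrite i0 j0 in ij.
rewrite /P poisson2_setC -/P P0 subrr => Plt.
have /eqP -> : P [set x | (x.1 < x.2)%N] == 0 by rewrite eq_le Plt poisson2_ge0.
by rewrite P1 add0r mulr1.
Qed.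

(** The two rates add up to [2 * lambda], so each event changes by at most [2 * (y - x)]. The
    weights 1 and 1/2 give the factor 3, rounded up to 4. *)
Lemma B_S_dist (x y : R) : 0 <= x <= y ->
  `|B_S alpha y - B_S alpha x| <= 4 * (y - x).
Proof.
move=> /andP[x0 xy]; rewrite !B_SE.
have /andP[s0 s1] := s_star_bounds.
have D A : `|poisson2 R (y * (1 + s)) (y * (1 - s)) A -
             poisson2 R (x * (1 + s)) (x * (1 - s)) A| <= 2 * (y - x).
  apply: le_trans (@poisson2_dist R _ _ _ _ A _ _) _.
  - by rewrite mulr_ge0 ?ler_wpM2r//; lra.
  - by rewrite mulr_ge0 ?ler_wpM2r//; lra.
  - by rewrite le_eqVlt; apply/orP; left; apply/eqP; ring.
have := D [set x | (x.1 < x.2)%N]; have := D [set x | x.1 = x.2].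
move: (poisson2 R _ _ _) (poisson2 R _ _ _).
move: (poisson2 R _ _ _) (poisson2 R _ _ _).
by move=> p q p' q'; rewrite !ler_norml; lra.
Qed.

Lemma B_S_le (lambda : R) : 0 <= lambda ->
  B_S alpha lambda <= expR (- (2 * lambda * (2 - alpha))).
Proof.
move=> l0; have [a0 b0] := poisson_ratesP _ l0.
have /andP[s0 s1] := s_star_bounds.
have /andP[? ?] := halpha.
(* Since [(1 + s) * (1 - s) = (alpha - 1) ^+ 2], this tilt gives both variables the same rate
   [lambda * (alpha - 1)], which minimises the Chernoff exponent. *)
pose t := (alpha - 1) / (1 + s).
have t0 : 0 < t by rewrite divr_gt0//; lra.
have tV : t^-1 * (1 - s) = alpha - 1.
  rewrite /t invf_div -mulrA mulrC -mulrA (mulrC (_ - _) (1 + s)).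
  rewrite (_ : (1 + s) * (1 - s) = 1 - s ^+ 2); last by ring.
  by rewrite s_star_sqr; field; lra.
have ts : t * (1 + s) = alpha - 1 by rewrite divfK//; lra.
have t1 : t <= 1.
  have s1a : (1 - s) * (1 + s) = (alpha - 1) ^+ 2.
    by rewrite (_ : _ * _ = 1 - s ^+ 2); [rewrite s_star_sqr; ring|ring].
  rewrite ler_pdivrMr ?mul1r; lra.
have -> : - (2 * lambda * (2 - alpha)) =
    (t - 1) * (lambda * (1 + s)) + (t^-1 - 1) * (lambda * (1 - s)).
  rewrite [RHS](_ : _ = lambda * (t * (1 + s)) + lambda * (t^-1 * (1 - s))
    - 2 * lambda); last by ring.
  by rewrite ts tV; ring.
apply: le_trans (@poisson2_le_chernoff R _ _ t a0 b0 _); last by rewrite t0 t1.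
rewrite B_SE; set P := poisson2 R _ _.
have -> : [set x : nat * nat | (x.1 <= x.2)%N] =
    [set x | (x.1 < x.2)%N] `|` [set x | x.1 = x.2].
  apply/seteqP; split=> -[i j] /=.
    by rewrite leq_eqVlt => /orP[/eqP|]; [right|left].
  by move=> [/ltnW|->].
rewrite /P poisson2U; last first.
  by rewrite -subset0 => -[i j] [/= + ij]; rewrite ij ltnn.
by rewrite lerD2l ler_piMl ?poisson2_ge0// invf_le1// ler1n.
Qed.

(** The left side is half the mass of the diagonal atom [(k, k)]: the rates sum to [2 * lambda] and
    their product is [(lambda * (alpha - 1)) ^+ 2]. *)
Lemma B_S_ge_atom (lambda : R) k : 0 <= lambda ->
  2^-1 * (expR (- (2 * lambda)) * ((lambda * (alpha - 1)) ^+ k / k`!%:R) ^+ 2)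
    <= B_S alpha lambda.
Proof.
move=> l0; have [a0 b0] := poisson_ratesP _ l0; rewrite B_SE.
apply: (@le_trans _ _ (2^-1 * poisson2 R (lambda * (1 + s)) (lambda * (1 - s))
   [set (k, k)])); last first.
  apply: ler_wpDl; first exact: poisson2_ge0.
  by rewrite ler_wpM2l ?invr_ge0//; apply: poisson2_le => _ ->.
rewrite ler_wpM2l ?invr_ge0// poisson2_set1// /poisson_mass.
rewrite le_eqVlt; apply/orP; left; apply/eqP.
rewrite [RHS](_ : _ =
  (expR (- (lambda * (1 + s))) * expR (- (lambda * (1 - s)))) *
  ((lambda * (1 + s)) ^+ k * (lambda * (1 - s)) ^+ k) / k`!%:R ^+ 2); last first.
  by field; rewrite pnatr_eq0 -lt0n fact_gt0.
rewrite -expRD -exprMn -mulrA; congr (expR _ * _); first by ring.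
rewrite expr_div_n -exprM mulnC exprM; congr (_ ^+ _ / _).
rewrite mulrACA -expr2 (_ : (1 + s) * (1 - s) = 1 - s ^+ 2); last by ring.
by rewrite s_star_sqr; ring.
Qed.

End skellam_rates.

(** * Elementary estimates on the exponential, and an intermediate value theorem *)

(** A Stirling-type bound, [n! <= n^(n+1) * e^(1-n)] at [n = k.+1]. The induction reduces to
    [e <= (1 + 1/(k+1))^(k+2)]. *)
Lemma expR_fact_le (R : realType) (k : nat) :
  expR (k%:R : R) * k.+1`!%:R <= k.+1%:R ^+ k.+2.
Proof.
elim: k => [|k IH]; first by rewrite expR0 mul1r expr1n.
have k1 : 0 < k.+1%:R :> R by rewrite ltr0n.
have k2 : 0 < k.+2%:R :> R by rewrite ltr0n.
have kE : k.+2%:R = k.+1%:R + 1 :> R by rewrite -natr1.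
(* [exp (1 / (k + 2)) <= (k + 2) / (k + 1)], from [exp (- u) >= 1 - u] *)
have step : expR 1 * k.+1%:R ^+ k.+2 <= k.+2%:R ^+ k.+2 :> R.
  have e1 : expR 1 = expR (k.+2%:R^-1 : R) ^+ k.+2.
    by rewrite -expRM_natr mulVf// gt_eqF.
  rewrite e1 -exprMn; apply: lerXn2r; rewrite ?nnegrE ?mulr_ge0 ?expR_ge0//.
  rewrite -ler_pdivlMl ?expR_gt0// -expRN.
  have : (1 - k.+2%:R^-1) * k.+2%:R <= expR (- k.+2%:R^-1) * k.+2%:R :> R.
    by rewrite ler_pM2r// expR_ge1Dx.
  by rewrite mulrBl mul1r mulVf ?gt_eqF// kE addrK.
rewrite factS natrM -natr1 expRD.
have -> : expR k%:R * expR 1 * (k.+2%:R * k.+1`!%:R) =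
  k.+2%:R * (expR 1 * (expR k%:R * k.+1`!%:R)) :> R by ring.
by rewrite [leRHS]exprS ler_pM2l// (le_trans _ step)// ler_pM2l ?expR_gt0.
Qed.

(** The witness is the integer part of [x], where the terms of the exponential series peak. For
    [x >= 1] it is written [k.+1], and the shift by 2 pays for [x < k + 2]. *)
Lemma expR_le_max_term (R : realType) (x : R) : 0 <= x ->
  exists k, expR (x - 2) <= (1 + x) * (x ^+ k / k`!%:R).
Proof.
move=> x0; have [x1|x1] := leP 1 x; last first.
  exists 0%N; rewrite expr0 fact0 divr1 mulr1.
  by rewrite (@le_trans _ _ 1)// ?expR_le1 ?lerDl//; lra.
have := truncn_itv x0; have := truncn_gt0 x; rewrite x1.
case: (Num.truncn x) => // k _ /andP[kx xk].
exists k.+1.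
have f0 : 0 < k.+1`!%:R :> R by rewrite ltr0n fact_gt0.
rewrite mulrA ler_pdivlMr//.
apply: (@le_trans _ _ (expR k%:R * k.+1`!%:R)).
  by rewrite ler_pM2r// ler_expR; rewrite -!natr1 in xk; lra.
apply: (le_trans (expR_fact_le R k)).
apply: (@le_trans _ _ (x ^+ k.+2)); first by rewrite lerXn2r ?nnegrE ?ler0n.
by rewrite exprS ler_wpM2r ?exprn_ge0// lerDr.
Qed.

(** Absorbs a polynomial factor into an exponential of arbitrarily small slope:
    [(1 + u) * (1 + v) <= expR (u + v)] with [u * v = x]. *)
Lemma le1Dx_expR (R : realType) (c x : R) : 0 < c -> 0 <= x ->
  1 + x <= expR (c * x / 2 + 2 / c).
Proof.
move=> c0 x0; rewrite expRD.
have e1 := expR_ge1Dx (c * x / 2); have e2 := expR_ge1Dx (2 / c).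
have p1 : 0 <= c * x / 2 by rewrite !mulr_ge0// ltW.
have p2 : 0 <= 2 / c by rewrite divr_ge0// ltW.
apply: (@le_trans _ _ ((1 + c * x / 2) * (1 + 2 / c))).
  have -> : (1 + c * x / 2) * (1 + 2 / c) = 1 + x + (c * x / 2 + 2 / c).
    by field; rewrite gt_eqF.
  by rewrite lerDl addr_ge0.
by rewrite ler_pM// addr_ge0.
Qed.

Lemma IVT_lipschitz (R : realType) (f : R -> R) (k M v : R) :
  0 < k -> 0 <= M ->
  (forall x y, 0 <= x <= y -> `|f y - f x| <= k * (y - x)) ->
  f M <= v <= f 0 -> exists2 c, 0 <= c & f c = v.
Proof.
move=> k0 M0 f_lip /andP[fMv vf0].
(* Extending [f] by the constant [f 0] on the left gives continuity on the whole line and avoids a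
   one-sided limit at 0. *)
pose g x := f (Num.max 0 x).
have g_lip x y : y <= x -> `|g x - g y| <= k * `|x - y|.
  move=> yx; rewrite /g.
  have yx0 : 0 <= Num.max 0 y <= Num.max 0 x.
    by rewrite le_max lexx ge_max !le_max lexx yx orbT.
  apply: (le_trans (f_lip _ _ yx0)).
  rewrite ler_pM2l// ger0_norm ?subr_ge0//.
  by have [x0|x0] := leP 0 x; have [y0|y0] := leP 0 y; lra.
have g_cont : continuous g.
  move=> x; apply/cvgrPdist_le => e e0.
  near=> y.
  have : `|g x - g y| <= k * `|x - y|.
    have [/g_lip//|/ltW/g_lip] := leP y x.
    by rewrite (distrC (g x)) (distrC x).
  move=> /le_trans; apply.
  rewrite -ler_pdivlMl// mulrC.
  near: y; apply: cvgr_dist_le => //.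
  by rewrite divr_gt0.
have : exists2 c, c \in `[0, M] & g c = v.
  apply: IVT => //; first exact: continuous_subspaceT.
  by rewrite /g maxxx max_r// ge_min le_max fMv vf0 orbT.
move=> [c]; rewrite in_itv/= => /andP[c0 _] gc.
by exists c => //; rewrite -gc /g max_r.
Unshelve. all: by end_near. Qed.

(** * The inverse of [B_S] and its logarithmic bounds *)

Section inverse.
Context {R : realType} {alpha : R} (halpha : 1 < alpha < 2).

(** Here 5 is 1 from [expR (- 1) <= 2^-1] plus 4 from squaring [expR (x - 2)]. Squaring also doubles
    [c * x / 2 + 2 / c], the cost of the factor [1 + x]. *)
Lemma B_S_ge (c lambda : R) : 0 < c -> 0 <= lambda ->
  expR (- (2 * lambda * (2 - alpha) + 5 + c * (lambda * (alpha - 1)) + 4 / c))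
    <= B_S alpha lambda.
Proof.
move=> c0 l0; have /andP[a1 a2] := halpha.
set x := lambda * (alpha - 1).
have x0 : 0 <= x by rewrite mulr_ge0//; lra.
have [k xk] := expR_le_max_term R x x0.
have m0 : 0 <= x ^+ k / k`!%:R by rewrite divr_ge0 ?exprn_ge0.
move: (B_S_ge_atom halpha lambda k l0) => /(le_trans _); apply.
rewrite -/x; set m := x ^+ k / k`!%:R in xk m0 *.
have em : expR (x - 2 - (c * x / 2 + 2 / c)) <= m.
  rewrite expRB ler_pdivrMr ?expR_gt0// (le_trans xk)// mulrC.
  by rewrite ler_wpM2l// le1Dx_expR.
have half : expR (- 1) <= 2^-1 :> R.
  rewrite expRN lef_pV2 ?posrE ?expR_gt0//.
  by have := expR_ge1Dx (1 : R); lra.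
have -> : - (2 * lambda * (2 - alpha) + 5 + c * x + 4 / c) =
    - 1 + (- (2 * lambda) + (x - 2 - (c * x / 2 + 2 / c)) *+ 2).
  by rewrite /x mulr2n; field; rewrite gt_eqF.
rewrite expRD expRD mulr2n expRD -expr2.
apply: ler_pM => //; rewrite ?mulr_ge0 ?exprn_ge0 ?expR_ge0//.
rewrite ler_wpM2l ?expR_ge0//.
by rewrite lerXn2r ?nnegrE ?expR_ge0.
Qed.

Lemma B_S_surj (beta : R) : 0 < beta < 2^-1 ->
  exists2 lambda, 0 <= lambda & B_S alpha lambda = beta.
Proof.
move=> /andP[b0 b1]; have /andP[a1 a2] := halpha.
(* The point at which the exponential upper bound on [B_S] equals [beta]. *)
pose M := - ln beta / (2 * (2 - alpha)).
have lb : ln beta <= 0 by rewrite ln_le0//; lra.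
have M0 : 0 <= M by rewrite divr_ge0 ?oppr_ge0// mulr_ge0//; lra.
have BM : B_S alpha M <= beta.
  apply: (le_trans (B_S_le halpha M M0)).
  rewrite -[leRHS]lnK ?posrE// ler_expR le_eqVlt; apply/orP; left; apply/eqP.
  by rewrite /M; field; rewrite subr_eq0 eq_sym lt_eqF.
apply: (IVT_lipschitz _ (B_S alpha) 4 M) => //.
- by move=> x y; exact: B_S_dist.
- by rewrite BM B_S_0// ltW.
Qed.

(** Surjectivity onto []0, 2^-1[] makes the pseudo-inverse pick a genuine preimage in [[0, +oo[]
    instead of its default value. *)
Lemma lambda_starP (beta : R) : 0 < beta < 2^-1 ->
  0 <= lambda_star alpha beta /\ B_S alpha (lambda_star alpha beta) = beta.
Proof.
move=> hb.
have surj : set_surj `[0, +oo[ `]0, 2^-1[ (B_S alpha).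
  move=> b; rewrite /= in_itv/= => /B_S_surj[l l0 <-].
  by exists l => //=; rewrite in_itv/= l0.
have bI : `]0, 2^-1[%classic beta by rewrite /= in_itv.
have pinvE : B_S alpha (lambda_star alpha beta) = beta.
  by apply: (@surjpK _ _ (fun=> 0) _ _ _ surj); rewrite inE.
split=> //.
suff : `[0, +oo[%classic (lambda_star alpha beta) by rewrite /= in_itv/= andbT.
by apply: (@surjpinv_image_sub _ _ (fun=> 0) _ _ _ surj); exact: imageP.
Qed.

Lemma lambda_star_bounds (c beta : R) : 0 < c -> 0 < beta < 2^-1 ->
  let l := lambda_star alpha beta in
  2 * l * (2 - alpha) <= ln (1 / beta) <=
    2 * l * (2 - alpha) + 5 + c * (l * (alpha - 1)) + 4 / c.
Proof.
move=> c0 /[dup] /andP[b0 _] /lambda_starP[+ +] /=.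
move: (lambda_star alpha beta) => l l0 lE.
have := B_S_le halpha _ l0; have := B_S_ge c _ c0 l0.
rewrite lE -[beta]lnK ?posrE// !ler_expR lnK ?posrE// => lo hi.
by rewrite div1r lnV ?posrE//; apply/andP; split; lra.
Qed.

(** All bases are positive, so both sides are exponentials of combinations of logarithms:
    [ln (alpha - 1)] cancels, and [ln alpha] and [ln (2 - alpha)] each keep the coefficient 1/2. *)
Lemma L_constE :
  L_const alpha * (2 - alpha) `^ ((alpha - 1) / alpha) = s_star alpha.
Proof.
have /andP[a1 a2] := halpha.
have pa : 0 < alpha by lra.
have p1 : 0 < alpha - 1 by lra.
have p2 : 0 < 2 - alpha by lra.
have sE : s_star alpha = expR (2^-1 * (ln alpha + ln (2 - alpha))).
  rewrite /s_star -powR12_sqrt ?mulr_ge0 ?ltW// /powR mulf_eq0 !gt_eqF//=.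
  by rewrite lnM ?posrE.
have pw u v : 0 < u -> u `^ v = expR (v * ln u).
  by move=> u0; rewrite /powR gt_eqF.
rewrite /L_const /C_const sE !pw ?divr_gt0 ?mulr_gt0 ?expR_gt0//.
rewrite -expRD expRK -[X in X * _ / _]lnK ?posrE// -expRD -expRB -expRD.
by congr expR; rewrite !ln_div ?posrE//; field; rewrite gt_eqF.
Qed.

End inverse.

(** * The asymptotic equivalence as [beta] decreases to 0 *)

Theorem corollary2 (R : realType) (alpha : R) (halpha : 1 < alpha < 2) :
  exists eps : R -> R,
    eps beta @[beta --> 0^'+] --> (0 : R) /\
    forall beta : R, 0 < beta < 2^-1 ->
      s_star alpha * (2 * lambda_star alpha beta) `^ ((alpha - 1) / alpha) =
      L_const alpha * ln (1 / beta) `^ ((alpha - 1) / alpha) * (1 + eps beta).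
Proof.
have /andP[a1 a2] := halpha.
have D0 : 0 < 2 - alpha by lra.
pose g : R := (alpha - 1) / alpha.
have g0 : 0 < g by rewrite divr_gt0//; lra.
have g1 : g <= 1 by rewrite ler_pdivrMr ?mul1r; lra.
pose r beta := 2 * lambda_star alpha beta * (2 - alpha) / ln (1 / beta).
(* This error term makes the identity exact by [L_constE]; the limit then amounts to the convergence
   of [r beta] to 1. *)
exists (fun beta => r beta `^ g - 1); split; last first.
  move=> beta hb; have [l0 _] := lambda_starP halpha beta hb.
  have y0 : 0 < ln (1 / beta).
    move/andP: hb => [b0 b1].
    by rewrite ln_gt0// ltr_pdivlMr ?mul1r//; lra.
  have r0 : 0 <= r beta by rewrite /r divr_ge0 ?mulr_ge0// ltW.
  rewrite -/g subrKC -mulrA -powRM// ?(ltW y0)// /r [ln _ * _]mulrC.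
  rewrite divfK ?gt_eqF// -(L_constE halpha) -/g -mulrA.
  by rewrite -powRM ?mulr_ge0// ?(ltW D0)// [(2 - _) * _]mulrC.
apply/cvgrPdist_le => e e0.
(* With [y = ln (1 / beta)], this [c] keeps the error linear in [lambda_star] below [e * y / 2], and
   [y > Y] keeps the constant [5 + 4 / c] below [e * y / 2]. *)
pose c := e * (2 - alpha).
have c0 : 0 < c by rewrite mulr_gt0.
pose Y := (5 + 4 / c) * 2 / e.
have Y0 : 0 < Y by rewrite !mulr_gt0 ?invr_gt0// addr_gt0// divr_gt0.
near=> beta.
have b0 : 0 < beta by near: beta; exact: nbhs_right_gt.
have b1 : beta < 2^-1 by near: beta; apply: nbhs_right_lt; rewrite invr_gt0.
have bY : beta < expR (- Y).
  by near: beta; apply: nbhs_right_lt; rewrite expR_gt0.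
have hb : 0 < beta < 2^-1 by rewrite b0 b1.
have [l0 _] := lambda_starP halpha beta hb.
have := lambda_star_bounds halpha c beta c0 hb.
rewrite /= /r; move: (lambda_star alpha beta) l0 => l l0.
set y := ln (1 / beta) => /andP[lo hi].
have yY : Y < y.
  by rewrite /y div1r lnV ?posrE// ltrNr -ltr_expR lnK ?posrE.
have y0 : 0 < y by exact: lt_trans yY.
set q := _ / y.
have q0 : 0 <= q by rewrite divr_ge0 ?mulr_ge0// ltW.
have q1 : q <= 1 by rewrite ler_pdivrMr ?mul1r.
have eq : 1 - e <= q.
  rewrite ler_pdivlMr//.
  have : (5 + 4 / c) * 2 < y * e by rewrite -ltr_pdivrMr.
  have : c * (l * (alpha - 1)) <= e * (l * (2 - alpha)).
    rewrite /c -mulrA ler_pM2l// mulrCA mulrA.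
    by rewrite ler_piMr ?mulr_ge0 ?(ltW D0)//; lra.
  have : e * (2 * l * (2 - alpha)) <= e * y by rewrite ler_pM2l.
  lra.
have qg1 : q `^ g <= 1.
  have : q `^ g <= 1 `^ g by apply: ge0_ler_powR; rewrite ?nnegrE// ltW.
  by rewrite powR1.
(* On [[0, 1]] a power with exponent at most 1 only moves [q] closer to 1, so [1 - e <= q] passes to
   [q] raised to [g]. *)
have qg : q <= q `^ g.
  have [->|qn0] := eqVneq q 0; first exact: powR_ge0.
  by rewrite ger1_powR// lt0r qn0 q0.
by rewrite sub0r normrN ler_norml; apply/andP; split; lra.
Unshelve. all: by end_near. Qed.
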